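(* The decision problem ''given a graph $G$, does $o(G)=\mathcal{D}$ hold?'' is in $\mathsf{NP}$ when restricted to interval graphs $G$.
   Context: All graphs are finite and simple. An interval graph is the intersection graph of a family of closed intervals of the real line: each vertex corresponds to an interval, and two vertices are adjacent if and only if their intervals intersect. The Maker-Breaker domination game on a graph $G$: two players, Dominator and Staller, alternately claim a not-yet-claimed vertex of $G$. Dominator wins if at some point the vertices she has claimed form a dominating set of $G$. Otherwise, i.e. if Staller manages to claim a vertex and all its neighbors, Staller wins. The graph $G$ has outcome $\mathcal{D}$, written $o(G)=\mathcal{D}$, if Dominator has a winning strategy whoever starts (equivalently, if Dominator has a winning strategy when playing second, since no player benefits from skipping a turn). *)

(* Defs.v *)
From HB Require Import structures.
From mathcomp Require Import all_boot all_order all_algebra.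
From mathcomp Require Import reals.
Set Implicit Arguments.
Unset Strict Implicit.
Unset Printing Implicit Defensive.

Definition simple_graph (T : finType) (e : rel T) : Prop :=
  symmetric e /\ irreflexive e.

Definition interval_graph (R : realType) (T : finType) (e : rel T) : Prop :=
  exists l r : T -> R,
    (forall v, (l v <= r v)%R) /\
    (forall u v, e u v <->
       u != v /\ exists x : R, x \in `[l u, r u]%R /\ x \in `[l v, r v]%R).

Definition dominating (T : finType) (e : rel T) (D : {set T}) : bool :=
  [forall v, exists u in D, (u == v) || e u v].

(* A history of the game is the duplicate-free sequence of the vertices
   claimed so far, in chronological order; move number i (from 0) belongs to
   Dominator iff [dom_turn dom_starts i]. *)

Definition dom_turn (dom_starts : bool) (i : nat) : bool := odd i (+) dom_starts.

Definition dom_claims (T : finType) (dom_starts : bool) (h : seq T) : {set T} :=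
  [set v in h | dom_turn dom_starts (index v h)].

(* A strategy returns an option only so that strategies exist on the empty
   vertex set; a legal one always answers with an unclaimed vertex. *)
Definition legal_dom_strategy (T : finType) (dom_starts : bool)
    (sigma : seq T -> option T) : Prop :=
  forall h : seq T, uniq h -> size h < #|T| -> dom_turn dom_starts (size h) ->
    exists2 v, sigma h = Some v & v \notin h.

(* Plays are continued until every vertex is claimed; this is harmless, as a
   win of Dominator is recorded as soon as it occurs. *)
Definition complete_play (T : finType) (s : seq T) : Prop :=
  uniq s /\ size s = #|T|.

Definition follows (T : finType) (dom_starts : bool)
    (sigma : seq T -> option T) (s : seq T) : Prop :=
  forall i, i < size s -> dom_turn dom_starts i ->
    onth s i = sigma (take i s).

Definition dom_wins_play (T : finType) (e : rel T) (dom_starts : bool)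
    (s : seq T) : Prop :=
  exists t, dominating e (dom_claims dom_starts (take t s)).

Definition dom_has_winning_strategy (T : finType) (e : rel T)
    (dom_starts : bool) : Prop :=
  exists sigma : seq T -> option T,
    legal_dom_strategy dom_starts sigma /\
    forall s, complete_play s -> follows dom_starts sigma s ->
      dom_wins_play e dom_starts s.

Definition outcome_D (T : finType) (e : rel T) : Prop :=
  forall dom_starts : bool, dom_has_winning_strategy e dom_starts.

(* Deterministic multi-tape Turing machines.  Tapes are infinite to the right
   only, with cells numbered from 0, and a left move on cell 0 leaves the head
   in place.  Tape 0 initially holds the input, tape 1 the certificate, and
   the other [work_tapes M] tapes are blank. *)

Inductive move : Type := MoveLeft | Stay | MoveRight.

Definition move_head (m : move) (i : nat) : nat :=
  match m with MoveLeft => i.-1 | Stay => i | MoveRight => i.+1 end.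

(* [None] is the blank, [Some (inl b)] an input bit and [Some (inr a)] an
   auxiliary symbol of the machine. *)
Definition tape_symbol (A : finType) : finType := option (bool + A)%type.

Record TM : Type := {
  work_tapes : nat;
  aux : finType;
  state : finType;
  start : state;
  (* [None]: running; [Some b]: halted, accepting iff [b] *)
  verdict : state -> option bool;
  delta : state -> {ffun 'I_work_tapes.+2 -> tape_symbol aux} ->
          state * ('I_work_tapes.+2 -> tape_symbol aux * move)
}.

Record config (M : TM) : Type := Config {
  cstate : state M;
  head_pos : 'I_(work_tapes M).+2 -> nat;
  cell : 'I_(work_tapes M).+2 -> nat -> tape_symbol (aux M)
}.

Definition tape_of_word (A : finType) (w : seq bool) (i : nat) : tape_symbol A :=
  omap inl (onth w i).

Definition init_config (M : TM) (x u : seq bool) : config M :=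
  Config (start M) (fun _ => 0)
    (fun t => if t == 0 :> nat then tape_of_word _ x
              else if t == 1 :> nat then tape_of_word _ u
              else fun _ => None).

Definition step (M : TM) (c : config M) : config M :=
  if verdict (cstate c) is Some _ then c else
  let: (q, act) := delta (cstate c) [ffun t => cell c t (head_pos c t)] in
  Config q
    (fun t => move_head (act t).2 (head_pos c t))
    (fun t i => if i == head_pos c t then (act t).1 else cell c t i).

Definition verdict_after (M : TM) (x u : seq bool) (n : nat) : option bool :=
  verdict (cstate (iter n (@step M) (init_config M x u))).

Definition accepts (M : TM) (x u : seq bool) : Prop :=
  exists n, verdict_after M x u n = Some true.

Definition halts_within (M : TM) (x u : seq bool) (n : nat) : Prop :=
  exists b, verdict_after M x u n = Some b.

Definition polynomial_time (M : TM) : Prop :=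
  exists c d : nat, forall x u,
    let N := size x + size u in halts_within M x u (c * N ^ d + c).

Definition NP (L : seq bool -> Prop) : Prop :=
  exists (M : TM) (c d : nat), polynomial_time M /\
    forall x, L x <->
      exists2 u, size u <= c * size x ^ d + c & accepts M x u.

(* The number of vertices in unary, a separator, and the adjacency matrix in
   row-major order. *)
Definition encode_graph (n : nat) (e : rel 'I_n) : seq bool :=
  nseq n true ++ false :: [seq e i j | i <- enum 'I_n, j <- enum 'I_n].

(* Restricting the problem to interval graphs is read as intersecting the
   language with that of the encodings of interval graphs, so that [NP] applies
   to a language rather than to a promise problem. *)
Definition interval_outcome_D (R : realType) (w : seq bool) : Prop :=
  exists (n : nat) (e : rel 'I_n),
    [/\ simple_graph e, interval_graph R e, outcome_D e & w = encode_graph e].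

(* Main.v *)
Require Import Defs.
From mathcomp Require Import all_boot all_order all_algebra.
From mathcomp Require Import boolp reals zify.
Set Implicit Arguments.
Unset Strict Implicit.
Unset Printing Implicit Defensive.
Import Order.TTheory GRing.Theory Num.Theory.

(** On an interval graph Dominator wins as second player if and only if there
    are pairwise disjoint pairs of vertices such that every closed
    neighbourhood contains one of them: the pairs are produced by induction from
    a winning strategy, as in [pairable_reply].  A certificate consists of these
    pairs and of the relation "u starts before v ends", which is subject only to
    the Ferrers condition and determines the graph.  Its validity is a
    first-order property of two n x n bit matrices and of the adjacency matrix,
    hence the value of an arithmetic term with bounded sums, and such terms are
    evaluated in polynomial time by a counter program, that is by a Turing
    machine whose head positions are the counters. *)

(** * From strategies to pairings *)

(** That a pairing lets Dominator win is true in every graph; the converse needs intervals, and it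
    replaces an exponentially large object, a strategy, by one of quadratic size. The induction goes
    backwards over histories and keeps two sets apart: the unclaimed vertices, which supply the
    pairs, and the undominated ones, whose closed neighbourhoods must contain a pair. Real endpoints
    cannot be written in a certificate, but adjacency depends only on comparisons of left with right
    endpoints, which form a Boolean matrix. Any reflexive Ferrers matrix comes from some intervals,
    possibly other than the original ones, so checking it also proves that the graph is an interval
    graph. Terms have no exponentiation, so the values of a fixed term are polynomial in the input
    size, and unary counters, whose cost is proportional to their values, are fast enough. *)

Section Pairable.
Context {d : Order.disp_t} {R : orderType d} {T : finType}.
Variables l r : T -> R.
Local Open Scope order_scope.

Definition meets (a w : T) : bool := (l a <= r w) && (l w <= r a).

(** In the game [A] holds the unclaimed vertices and [X] those not yet dominated; [M] is a partial
    matching inside [A]. *)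
Definition pairable (A X : {set T}) : Prop :=
  exists M : rel T,
    [/\ symmetric M,
        forall a b, M a b -> (a \in A) && (a != b),
        forall a b c, M a b -> M a c -> b = c
      & forall w, w \in X -> exists a b, [/\ M a b, meets a w & meets b w]].

(** The pair [a], [y] is added: whatever meets the inner interval [y] also meets [a], and the other
    vertices of [X] are served by the given pairs, which avoid both. *)
Lemma pairable_nested (A X : {set T}) (a y : T) :
    a \in A -> y \in A :\ a -> l a <= l y -> r y <= r a ->
    pairable (A :\ a :\ y) (X :\: [set w | meets y w]) ->
  pairable A X.
Proof.
move=> aA /setD1P[ya yA] ly ry [M [Msym MA Mf MX]].
exists (fun u v => [|| M u v, (u == a) && (v == y) | (u == y) && (v == a)]).
have MN u v : M u v -> [/\ u != a, u != y, v != a & v != y].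
  move=> Muv; have := MA _ _ Muv; rewrite !inE -!andbA => /and4P[-> -> _ _].
  have := MA v u; rewrite Msym Muv => /(_ isT).
  by rewrite !inE -!andbA => /and4P[-> -> _ _].
split.
- by move=> u v; rewrite Msym; congr (_ || _); rewrite orbC !(andbC (v == _)).
- move=> u v /or3P[/MA|/andP[/eqP-> /eqP->]|/andP[/eqP-> /eqP->]].
  + by rewrite !inE => /andP[/andP[_ /andP[_ ->]] ->].
  + by rewrite aA eq_sym.
  + by rewrite yA.
- move=> u v w.
  case/or3P=> [Muv|/andP[/eqP-> /eqP->]|/andP[/eqP-> /eqP->]].
  + have [/negbTE ua /negbTE uy _ _] := MN _ _ Muv.
    by rewrite ua uy /= !orbF => /(Mf _ _ _ Muv).
  + rewrite eqxx (eq_sym a) (negbTE ya) /= orbF.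
    by case/orP=> [/MN[/eqP//]|/eqP->].
  + rewrite eqxx (negbTE ya) /=.
    by case/orP=> [/MN[_ /eqP//]|/eqP->].
- move=> w wX; case: (boolP (meets y w)) => yw.
    exists y, a; rewrite !eqxx !orbT; split=> //.
    by case/andP: yw => h1 h2; rewrite /meets (le_trans ly h1) (le_trans h2 ry).
  have [|u [v [Muv uw vw]]] := MX w; first by rewrite !inE yw.
  by exists u, v; rewrite Muv.
Qed.

Lemma leftmost_longest (P : pred T) : (exists a, P a) ->
  exists2 b, P b & forall c, P c -> l b <= l c /\ (r b < r c -> l b < l c).
Proof.
case=> a0 Pa0.
have [b1 Pb1 b1min] : exists2 b1, P b1 & forall c, P c -> l b1 <= l c.
  by case: (Order.TotalTheory.arg_minP l Pa0) => b1; exists b1.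
have Qb1 : P b1 && (l b1 == l b1) by rewrite Pb1 eqxx.
case: (@Order.TotalTheory.arg_maxP _ _ _ b1 (fun c => P c && (l c == l b1)) r Qb1).
move=> b /andP[Pb /eqP lb] bmax.
exists b => // c Pc; rewrite lb; split=> [|rbc]; first exact: b1min.
rewrite lt_neqAle b1min // andbT; apply: contraTneq rbc => lc.
by rewrite -leNgt; apply: bmax; rewrite Pc lc /=.
Qed.

(* If no reply is nested in the interval it answers, then there are consecutive
   inclusion-maximal intervals b and b' such that the reply to b sticks out to
   the right and the reply to b' to the left.  No interval of A starts before
   b' and ends after b, so the left part of the pairing obtained after playing
   b, the right part of the one obtained after playing b', and the pair
   (b, b') are disjoint. *)
Lemma pairable_reply (A X : {set T}) :
    A != set0 ->
    (forall a, a \in A -> exists2 y, y \in A :\ a &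
       pairable (A :\ a :\ y) (X :\: [set w | meets y w])) ->
  pairable A X.
Proof.
move=> /set0Pn[a0 a0A] reply.
have /fin_all_exists[f Hf] a : exists y, a \in A -> y \in A :\ a /\
    pairable (A :\ a :\ y) (X :\: [set w | meets y w]).
  by case: (boolP (a \in A)) => [/reply[y]|_]; [exists y | exists a].
case: (boolP [exists a in A, (l a <= l (f a)) && (r (f a) <= r a)]).
  case/exists_inP=> a aA /andP[la ra]; have [fA Hp] := Hf a aA.
  exact: pairable_nested Hp.
move=> /exists_inPn nonnested.
have side a : a \in A -> l (f a) < l a \/ r a < r (f a).
  by move=> /nonnested; rewrite negb_and -!ltNge => /orP.
have fA a : a \in A -> f a \in A by move=> /Hf[/setD1P[]].
(* Maximality is one-sided: only containment in an interval that ends strictly later is excluded. *)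
pose mx b := (b \in A) && [forall c in A, (r b < r c) ==> (l b < l c)].
have mxP b c : mx b -> c \in A -> r b < r c -> l b < l c.
  by case/andP=> _ /forall_inP + cA => /(_ c cA)/implyP.
have [b0 b0A b0P] := @leftmost_longest [pred c | c \in A] (ex_intro _ a0 a0A).
have mxb0 : mx b0.
  rewrite /mx [b0 \in A]b0A; apply/forall_inP => c cA; apply/implyP.
  by have [] := b0P c cA.
(* Nothing in [A] starts before [b0], so its reply can only stick out to the right. Hence there is a
   candidate for [b], chosen next to end last. *)
have rb0 : mx b0 && (r b0 < r (f b0)).
  rewrite mxb0; case: (side _ b0A) => // lf.
  have [] := b0P _ (fA _ b0A); by rewrite leNgt lf.
case: (@Order.TotalTheory.arg_maxP _ _ _ b0 (fun b => mx b && (r b < r (f b))) r rb0).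
move=> b /andP[mxb rfb] bmax {b0 b0A b0P mxb0 rb0}.
have bA : b \in A by case/andP: mxb.
have [b' /andP[b'A rb'] b'P] := @leftmost_longest
  (fun c => (c \in A) && (r b < r c)) (ex_intro _ (f b) (introT andP (conj (fA _ bA) rfb))).
have mxb' : mx b'.
  rewrite /mx b'A; apply/forall_inP => c cA; apply/implyP => rc.
  by have [_] := b'P c (introT andP (conj cA (lt_trans rb' rc))); apply.
have lbb' : l b < l b' by exact: mxP.
(* A reply sticking out to the right would make [b'] a candidate ending after [b]. *)
have lfb' : l (f b') < l b'.
  case: (side _ b'A) => // rf.
  have : r b' <= r b by apply: bmax; rewrite mxb' rf.
  by rewrite leNgt rb'.
have split c : c \in A -> r b < r c -> l b' <= l c.
  by move=> cA rc; have [] := b'P c (introT andP (conj cA rc)).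
have lfb : l b' <= l (f b) by apply: split => //; exact: fA.
have rfb' : r (f b') <= r b.
  by rewrite leNgt; apply: contraTN lfb' => /split; rewrite -leNgt; apply; exact: fA.
have [_ [M [Msym MA Mf MX]]] := Hf b bA.
have [_ [M' [M'sym M'A M'f M'X]]] := Hf b' b'A.
have {}MA u v : M u v -> [/\ u \in A, u != v & u != b].
  by move=> /MA; rewrite !inE => /andP[/and3P[_ -> ->] ->].
have {}M'A u v : M' u v -> [/\ u \in A, u != v & u != b'].
  by move=> /M'A; rewrite !inE => /andP[/and3P[_ -> ->] ->].
have bb' : b != b' by apply: contraTneq rb' => ->; rewrite ltxx.
pose N u v := [&& M u v, l u < l b' & l v < l b'].
pose N' u v := [&& M' u v, r b < r u & r b < r v].
pose B u v := ((u == b) && (v == b')) || ((u == b') && (v == b)).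
have Nsym : symmetric N by move=> u v; rewrite /N Msym; congr (_ && _); rewrite andbC.
have N'sym : symmetric N' by move=> u v; rewrite /N' M'sym; congr (_ && _); rewrite andbC.
have Bsym : symmetric B by move=> u v; rewrite /B orbC !(andbC (v == _)).
have NN' u v w : N u v -> N' u w -> False.
  move=> /and3P[/MA[uA _ _] lu _] /and3P[_ ru _].
  by have := split _ uA ru; rewrite leNgt lu.
have NB u v w : N u v -> B u w -> False.
  move=> /and3P[/MA[_ _ ub] lu _] /orP[]/andP[/eqP ue _]; move: ub lu; rewrite ue ?eqxx ?ltxx //.
have N'B u v w : N' u v -> B u w -> False.
  move=> /and3P[/M'A[_ _ ub] lu _] /orP[]/andP[/eqP ue _]; move: ub lu; rewrite ue ?eqxx ?ltxx //.
exists (fun u v => [|| N u v, N' u v | B u v]); split.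
- by move=> u v; rewrite Nsym N'sym Bsym.
- move=> u v /or3P[/and3P[/MA[-> ->]]|/and3P[/M'A[-> ->]]|] //.
  by case/orP=> /andP[/eqP-> /eqP->]; rewrite ?bA ?b'A //= eq_sym.
- move=> u v w /or3P[] Huv /or3P[] Huw.
  + by case/and3P: Huv => Mv _ _; case/and3P: Huw => Mw _ _; exact: Mf Mv Mw.
  + by case: (NN' _ _ _ Huv Huw).
  + by case: (NB _ _ _ Huv Huw).
  + by case: (NN' _ _ _ Huw Huv).
  + by case/and3P: Huv => Mv _ _; case/and3P: Huw => Mw _ _; exact: M'f Mv Mw.
  + by case: (N'B _ _ _ Huv Huw).
  + by case: (NB _ _ _ Huw Huv).
  + by case: (N'B _ _ _ Huw Huv).
  + by case/orP: Huv Huw => /andP[/eqP-> /eqP->]; rewrite /B ?eqxx ?(negbTE bb') ?(eq_sym b') ?(negbTE bb') /= ?orbF => /eqP.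
- move=> w wX.
  (* If [w] ends before [b'] starts, it misses [f b], so [M] serves it, by a pair in [N]; if it
     starts after [b] ends, it misses [f b'] and [N'] serves it; otherwise it meets both [b] and
     [b']. *)
  case: (ltP (r w) (l b')) => [rw|b'w].
    have [|u [v [Muv uw vw]]] := MX w.
      by rewrite !inE wX /meets negb_and -!ltNge (lt_le_trans rw lfb).
    exists u, v; split=> //; rewrite /N Muv.
    by case/andP: uw => /le_lt_trans/(_ rw)-> _; case/andP: vw => /le_lt_trans/(_ rw)->.
  case: (ltP (r b) (l w)) => [lw|wb].
    have [|u [v [Muv uw vw]]] := M'X w.
      by rewrite !inE wX /meets negb_and -!ltNge (le_lt_trans rfb' lw) orbT.
    exists u, v; split=> //; rewrite /N' Muv.
    by case/andP: uw => _ /(lt_le_trans lw)->; case/andP: vw => _ /(lt_le_trans lw)->; rewrite orbT.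
  exists b, b'; rewrite /B !eqxx !orbT; split=> //; rewrite /meets.
    by rewrite wb (le_trans (ltW lbb')).
  by rewrite b'w (le_trans wb (ltW rb')).
Qed.

End Pairable.

Lemma unclaimed_exists (T : finType) (h : seq T) :
  size h < #|T| -> exists v, v \notin h.
Proof.
move=> sh; apply/existsP; apply: contraLR sh => /existsPn hT.
rewrite -leqNgt; apply: leq_trans (card_size h); apply: subset_leq_card.
by apply/subsetP => v _; have := hT v; rewrite negbK.
Qed.

Lemma complete_play_mem (T : finType) (s : seq T) v : complete_play s -> v \in s.
Proof.
case=> us ss; suff -> : s =i predT by [].
by apply/subset_cardP; [rewrite (card_uniqP us) ss|apply/subsetP].
Qed.

(** * Pairing strategies in arbitrary graphs *)

Section Pairing.
Variables (T : finType) (e M : rel T).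

Definition pairing_reply (h : seq T) (b : T) : bool :=
  (b \notin h) && (if h is x :: h' then M (last x h') b else false).

Definition pairing_strategy (h : seq T) : option T :=
  if [pick b | pairing_reply h b] is Some b then Some b
  else [pick b | b \notin h].

Lemma pairing_strategy_legal ds : legal_dom_strategy ds pairing_strategy.
Proof.
move=> h _ sh _; rewrite /pairing_strategy; case: pickP => [b /andP[]|_]; first by exists b.
by case: pickP => [b|hT]; [exists b|have [b] := unclaimed_exists sh; rewrite hT].
Qed.

Hypothesis Msym : symmetric M.
Hypothesis Mirr : irreflexive M.
Hypothesis Mfun : forall a b c, M a b -> M a c -> b = c.

(** Consider the end of the pair that is claimed first. If Staller takes it, the other end is still
    free at the next move, which is Dominator's, and the strategy takes it. *)
Lemma pairing_strategy_claims ds (s : seq T) a b :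
    complete_play s -> follows ds pairing_strategy s -> M a b ->
  (a \in dom_claims ds s) || (b \in dom_claims ds s).
Proof.
move=> cs fs; wlog ltab : a b / index a s < index b s => [W Mab|Mab].
  case: (ltngtP (index a s) (index b s)) => [|lt|iab]; first by move/W; apply.
    by rewrite orbC W // Msym.
  have ab := index_inj a (complete_play_mem a cs) (complete_play_mem b cs) iab.
  by move: Mab; rewrite ab Mirr.
rewrite !inE !complete_play_mem //=.
case: (boolP (dom_turn ds (index a s))) => //= na.
set i := index a s in ltab na *.
have si : i.+1 < size s by apply: leq_ltn_trans ltab _; rewrite index_mem complete_play_mem.
have ti : dom_turn ds i.+1 by move: na; rewrite /dom_turn /=; case: (odd i); case: ds {fs}.
have tak : take i.+1 s = rcons (take i s) a.
  by rewrite (take_nth a (ltnW si)) nth_index // complete_play_mem.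
have bh : b \notin take i.+1 s.
  by rewrite in_take_leq ?(ltnW si) // -leqNgt.
have lastE (h : seq T) : pairing_reply (rcons h a) b = (b \notin rcons h a) && M a b.
  by case: h => // x h; rewrite /pairing_reply /= last_rcons.
have : onth s i.+1 = Some b.
  rewrite fs // tak /pairing_strategy; case: pickP => [c|/(_ b)].
    rewrite /pairing_reply => /andP[_]; case: (take i s) => [|x h] /=; rewrite ?last_rcons => Mac;
    by rewrite (Mfun Mab Mac).
  by rewrite lastE -tak bh Mab.
move=> /(onth_nth b) nb.
by rewrite -nb index_uniq //; case: cs.
Qed.

Lemma pairing_outcome_D :
    (forall v, exists a b, [/\ M a b, (a == v) || e a v & (b == v) || e b v]) ->
  outcome_D e.
Proof.
move=> Mdom ds; exists pairing_strategy; split; first exact: pairing_strategy_legal.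
move=> s cs fs; exists (size s); rewrite take_size; apply/forallP => v.
have [a [b [Mab av bv]]] := Mdom v.
by case/orP: (pairing_strategy_claims cs fs Mab) => h; apply/exists_inP; [exists a|exists b].
Qed.

End Pairing.

Lemma follows_rcons (T : finType) ds (sigma : seq T -> option T) h x :
    follows ds sigma h -> (dom_turn ds (size h) -> sigma h = Some x) ->
  follows ds sigma (rcons h x).
Proof.
move=> fh hx i; rewrite size_rcons ltnS -cats1 => ih ti; rewrite takel_cat //.
move: ih; rewrite leq_eqVlt onth_cat => /predU1P[ie|lti].
  by subst i; rewrite ltnn subnn take_size hx.
by rewrite lti fh.
Qed.

Lemma dom_claims_take (T : finType) ds (h : seq T) t :
  dom_claims ds (take t h) \subset dom_claims ds h.
Proof.
apply/subsetP => v; rewrite !inE => /andP[vt]; rewrite (mem_take vt) /=.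
by rewrite -[in index v h](cat_take_drop t h) index_cat vt.
Qed.

Lemma dom_claims_rcons (T : finType) ds (h : seq T) x : uniq (rcons h x) ->
  dom_claims ds (rcons h x) =
  if dom_turn ds (size h) then x |: dom_claims ds h else dom_claims ds h.
Proof.
rewrite rcons_uniq => /andP[xh uh].
have -> : forall b (A B : {set T}), (if b then A else B) = [set v | if b then v \in A else v \in B].
  by move=> b A B; apply/setP => v; rewrite inE; case: b.
apply/setP => v; rewrite !inE mem_rcons inE -cats1 index_cat /= eq_sym.
case: (eqVneq v x) => [->|vx] /=; last by case: (v \in h) (dom_turn _ (size h)) => [[]|[]].
by rewrite (negbTE xh) /= addn0; case: (dom_turn _ _).
Qed.

(** * Extracting a pairing from a winning strategy *)

Section StrategyToPairing.
Context {d : Order.disp_t} {R : orderType d} {T : finType}.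
Variables (l r : T -> R) (e : rel T).
Hypothesis eE : forall u v, (u == v) || e u v = meets l r u v.
Variable sigma : seq T -> option T.
Hypothesis legal : legal_dom_strategy false sigma.
Hypothesis wins : forall s, complete_play s -> follows false sigma s ->
  dom_wins_play e false s.

Let undominated (h : seq T) :=
  [set w | ~~ [exists u in dom_claims false h, meets l r u w]].

Lemma undominated_complete h : complete_play h -> follows false sigma h ->
  undominated h = set0.
Proof.
move=> ch fh; have [t /forallP dt] := wins ch fh.
apply/setP => w; rewrite !inE; apply/negbTE; rewrite negbK.
case/exists_inP: (dt w) => u; rewrite eE => /(subsetP (dom_claims_take _ _ _)) ud uw.
by apply/exists_inP; exists u.
Qed.

(** Backward induction: at even length Staller is to move, and [sigma] supplies to each of her
    claims the reply that [pairable_reply] asks for. *)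
Lemma pairable_history n (h : seq T) : #|T| - size h <= n ->
    uniq h -> ~~ odd (size h) -> follows false sigma h ->
  pairable l r [set v | v \notin h] (undominated h).
Proof.
elim: n h => [|n IHn] h hn uh oh fh; have sh : size h <= #|T| by rewrite -(card_uniqP uh) max_card.
  rewrite undominated_complete //; last first.
    by split=> //; apply/eqP; rewrite eqn_leq sh -subn_eq0 -leqn0.
  by exists (fun _ _ => false); split=> // w; rewrite inE.
have pairable0 (A : {set T}) : pairable l r A set0.
  by exists (fun _ _ => false); split=> // w; rewrite inE.
case: (eqVneq (size h) #|T|) => [hT|neT].
  by rewrite undominated_complete.
have hT : size h < #|T| by rewrite ltn_neqAle neT.
have [a0 a0h] := unclaimed_exists hT.
(* With a single vertex left, Staller takes it and there is no reply; Dominator's claims are then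
   final and already dominate. *)
case: (leqP #|T| (size h).+1) => hT2.
  have uh0 : uniq (rcons h a0) by rewrite rcons_uniq a0h.
  have <- : undominated (rcons h a0) = undominated h.
    by rewrite /undominated dom_claims_rcons // /dom_turn addbF (negbTE oh).
  rewrite undominated_complete //.
    by split=> //; rewrite size_rcons; lia.
  by apply: follows_rcons => //; rewrite /dom_turn addbF (negbTE oh).
apply: pairable_reply => [|a]; first by apply/set0Pn; exists a0; rewrite inE.
rewrite inE => ah.
have uha : uniq (rcons h a) by rewrite rcons_uniq ah.
have fha : follows false sigma (rcons h a).
  by apply: follows_rcons => //; rewrite /dom_turn addbF (negbTE oh).
have tha : dom_turn false (size (rcons h a)).
  by rewrite /dom_turn addbF size_rcons /= oh.
have [|y sy yh] := legal uha _ tha; first by rewrite size_rcons.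
have uhy : uniq (rcons (rcons h a) y) by rewrite rcons_uniq yh.
exists y; first by move: yh; rewrite mem_rcons in_setD1 !inE negb_or.
have -> : [set v | v \notin h] :\ a :\ y = [set v | v \notin rcons (rcons h a) y].
  by apply/setP => v; rewrite !inE !mem_rcons !inE mem_rcons !inE !negb_or.
have -> : undominated h :\: [set w | meets l r y w] = undominated (rcons (rcons h a) y).
  apply/setP => w; rewrite /undominated dom_claims_rcons // tha dom_claims_rcons //.
  rewrite {1}/dom_turn addbF (negbTE oh) !inE -negb_or; congr (~~ _).
  apply/orP/exists_inP => [[yw|/exists_inP[u uh1 uw]]|[u /setU1P[->|uh1] uw]].
  - by exists y; rewrite ?setU11.
  - by exists u => //; rewrite inE uh1 orbT.
  - by left.
  - by right; apply/exists_inP; exists u.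
apply: IHn => //.
- by rewrite !size_rcons; lia.
- by rewrite !size_rcons /= negbK.
- exact: follows_rcons.
Qed.

Lemma winning_pairable : pairable l r [set: T] [set: T].
Proof.
have := @pairable_history _ [::] (leqnn _) isT isT (fun i => _).
rewrite /undominated.
have -> : dom_claims false [::] = set0 :> {set T} by apply/setP => v; rewrite !inE.
have -> : [set w | ~~ [exists u in set0, meets l r u w]] = [set: T].
  by apply/setP => w; rewrite !inE; apply/exists_inPn => u; rewrite inE.
have -> : [set v | v \notin [::]] = [set: T] by apply/setP => v; rewrite !inE.
by apply.
Qed.

End StrategyToPairing.

(** * Certificates *)

(* [B u v] stands for "u starts before v ends", which by the Ferrers condition
   is the only information about the intervals that is needed, and [M] for the
   pairs of Dominator's pairing strategy. *)
Record certifies (T : finType) (e B M : rel T) : Prop := Certifies {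
  cert_refl : forall a, B a a;
  cert_edge : forall a b, e a b = [&& a != b, B a b & B b a];
  cert_ferrers : forall a b c d, B a d -> B c b -> B a b || B c d;
  cert_pair : forall a b, M a b -> M b a && (a != b);
  cert_fun : forall a b c, M a b -> M a c -> b = c;
  cert_dom : forall v, exists a b,
    [&& M a b, B v a, B a v, B v b & B b v]
}.

Lemma interval_graph_meets (R : realType) (T : finType) (e : rel T) :
  interval_graph R e -> exists2 lr : (T -> R) * (T -> R),
    forall v, (lr.1 v <= lr.2 v)%R &
    forall u v, e u v = (u != v) && meets lr.1 lr.2 u v.
Proof.
case=> l [r [lr eE]]; exists (l, r) => // u v; apply/idP/idP.
  case/eE => -> [x []]; rewrite !in_itv /= => /andP[lux xru] /andP[lvx xrv].
  by rewrite /meets (le_trans lux xrv) (le_trans lvx xru).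
case/andP=> uv /andP[luv lvu]; apply/eE; split=> //.
by exists (Num.max (l u) (l v)); rewrite !in_itv /= !le_max !ge_max !lexx ?orbT ?lr ?luv ?lvu.
Qed.

Lemma certifies_exists (R : realType) (T : finType) (e : rel T) :
    interval_graph R e -> outcome_D e ->
  exists B M, certifies e B M.
Proof.
move=> /interval_graph_meets[[l r] /= lr eE] /(_ false)[sigma [legal wins]].
have eqE u v : (u == v) || e u v = meets l r u v.
  by rewrite eE; case: eqVneq => [->|//]; rewrite /meets !lr.
have [M [Msym MA Mf MX]] := winning_pairable eqE legal wins.
exists (fun u v => (l u <= r v)%R), M; split.
- exact: lr.
- exact: eE.
(* Whichever of [b] and [d] ends later ends after the starts of both [a] and [c]. *)
- move=> a b c d ad cb; case: (leP (r b) (r d)) => bd.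
    by rewrite (le_trans cb bd) orbT.
  by rewrite (le_trans ad (ltW bd)).
- by move=> a b Mab; rewrite Msym Mab; case/andP: (MA a b Mab).
- exact: Mf.
- move=> v; have [|a [b [Mab /andP[av va] /andP[bv vb]]]] := MX v; first by rewrite inE.
  by exists a, b; rewrite Mab av va bv vb.
Qed.

Lemma certifies_simple (T : finType) (e B M : rel T) :
  certifies e B M -> simple_graph e.
Proof.
case=> Brefl eE _ _ _ _; split=> [u v|u]; last by rewrite eE eqxx.
by rewrite !eE eq_sym (andbC (B u v)).
Qed.

(* The rows of [B] form a chain, so [u] may start at the number of vertices
   outside its row, and [v] end at the last starting point in its column. *)
Lemma certifies_interval (R : realType) (T : finType) (e B M : rel T) :
  certifies e B M -> interval_graph R e.
Proof.
case=> Brefl eE Bf _ _ _.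
pose l u := #|[set v | ~~ B u v]|; pose r v := \max_(u | B u v) l u.
have BE u v : B u v = (l u <= r v).
  apply/idP/idP => [Buv|]; first exact: (leq_bigmax_cond (F := l)).
  have [w Bwv ->] : exists2 w, B w v & r v = l w.
    case: (@eq_bigmax_cond _ (fun u => B u v) l).
      by apply/card_gt0P; exists v; apply: Brefl.
    by move=> w Bwv rw; exists w.
  (* Here [w] attains the maximum [r v]. If [B u v] fails, the Ferrers condition puts the row of [u]
     inside that of [w], properly because of [v], so [l w < l u]. *)
  apply: contraTT => nB; rewrite -ltnNge; apply: proper_card.
  apply/properP; split; last by exists v; rewrite inE ?nB // Bwv.
  apply/subsetP => z; rewrite !inE; apply: contra => Buz.
  by have := Bf _ _ _ _ Buz Bwv; rewrite (negbTE nB).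
exists (fun u => (l u)%:R%R), (fun u => (r u)%:R%R); split.
  by move=> v; rewrite ler_nat -BE.
move=> u v; rewrite eE; split.
  case/and3P=> -> Buv Bvu; split=> //; exists (maxn (l u) (l v))%:R%R.
  by rewrite !in_itv /= !ler_nat !geq_max !leq_max !leqnn -!BE Buv Bvu !Brefl orbT.
case=> -> [x []]; rewrite !in_itv /= => /andP[lux xru] /andP[lvx xrv].
by rewrite !BE -!(ler_nat R) (le_trans lux xrv) (le_trans lvx xru).
Qed.

Lemma certifies_outcome_D (T : finType) (e B M : rel T) :
  certifies e B M -> outcome_D e.
Proof.
case=> Brefl eE _ MP Mf Md; apply: (@pairing_outcome_D _ _ M) => //.
- by move=> a b; apply/idP/idP => /MP/andP[].
- by move=> a; apply/negbTE/negP => /MP/andP[_ /eqP].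
- move=> v; have [a [b /and5P[Mab va av vb bv]]] := Md v.
  by exists a, b; rewrite !eE Mab va av vb bv !andbT !orbN.
Qed.

(** * Counter programs on Turing machines *)

Definition upd (s : nat -> nat) (k v : nat) : nat -> nat :=
  fun i => if i == k then v else s i.

Inductive guard := Nonzero of nat | InputTrue | InputDefined | CertTrue.

(* Registers 0 and 1 double as the positions of the heads on the input and on
   the certificate. *)
Definition guard_holds (x u : seq bool) (g : guard) (s : nat -> nat) : bool :=
  match g with
  | Nonzero k => s k != 0
  | InputTrue => nth false x (s 0)
  | InputDefined => s 0 < size x
  | CertTrue => nth false u (s 1)
  end.

Inductive cmd :=
  | Shift of move & nat
  | Seq of cmd & cmd
  | If of guard & cmd
  | While of guard & cmd.

(* [exec x u c s t s']: from registers [s], [c] ends after exactly [t] steps of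
   its compiled code with registers [s']. *)
Inductive exec (x u : seq bool) :
    cmd -> (nat -> nat) -> nat -> (nat -> nat) -> Prop :=
  | ExecShift m k s : exec x u (Shift m k) s 1 (upd s k (move_head m (s k)))
  | ExecSeq c1 c2 s1 s2 s3 t1 t2 :
      exec x u c1 s1 t1 s2 -> exec x u c2 s2 t2 s3 ->
      exec x u (Seq c1 c2) s1 (t1 + t2) s3
  | ExecIfTrue g c s s' t : guard_holds x u g s -> exec x u c s t s' ->
      exec x u (If g c) s t.+1 s'
  | ExecIfFalse g c s : ~~ guard_holds x u g s -> exec x u (If g c) s 1 s
  | ExecWhileTrue g c s1 s2 s3 t1 t2 : guard_holds x u g s1 ->
      exec x u c s1 t1 s2 -> exec x u (While g c) s2 t2 s3 ->
      exec x u (While g c) s1 (t1 + t2).+2 s3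
  | ExecWhileFalse g c s : ~~ guard_holds x u g s -> exec x u (While g c) s 1 s.

(* [Branch g p] jumps to [p] when [g] fails. *)
Inductive instr := Move of move & nat | Branch of guard & nat | Jump of nat.

(** Jump targets are absolute and [p] is the address of the first instruction. *)
Fixpoint compile (p : nat) (c : cmd) : seq instr :=
  match c with
  | Shift m k => [:: Move m k]
  | Seq c1 c2 => let l := compile p c1 in l ++ compile (p + size l) c2
  | If g c => let l := compile p.+1 c in Branch g (p + size l).+1 :: l
  | While g c =>
      let l := compile p.+1 c in Branch g (p + size l).+2 :: rcons l (Jump p)
  end.

Definition instr_step (x u : seq bool) (i : instr) (p : nat) (s : nat -> nat) :=
  match i with
  | Move m k => (p.+1, upd s k (move_head m (s k)))
  | Branch g q => (if guard_holds x u g s then p.+1 else q, s)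
  | Jump q => (q, s)
  end.

Definition instr_register (i : instr) : nat :=
  match i with Move _ k | Branch (Nonzero k) _ => k | _ => 0 end.

Section Machine.
Variables (c : cmd) (res : nat).

Let body := compile 0 c.
Let code := rcons body (Branch (Nonzero res) (size body).+2).
Let accepting := (size body).+1.
Let rejecting := (size body).+2.

Definition registers : nat := (\max_(k <- map instr_register code) k).+1.

Let K := registers.
Let marker : tape_symbol unit := Some (inr tt).

(* Tape [k.+2] holds a marker in cell 0 and its head position is the content of
   register [k]; tapes 0 and 1 move along with tapes 2 and 3. *)
Definition tape_register (t : nat) : nat := if t < 2 then t else t.-2.

Definition guard_test (g : guard) (syms : 'I_K.+2 -> tape_symbol unit) : bool :=
  match g with
  | Nonzero k => syms (inord k.+2) != marker
  | InputTrue => syms (inord 0) == Some (inl true)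
  | InputDefined => syms (inord 0) != None
  | CertTrue => syms (inord 1) == Some (inl true)
  end.

Definition instr_next (i : instr) (p : nat) (syms : 'I_K.+2 -> tape_symbol unit) : nat :=
  match i with
  | Move _ _ => p.+1
  | Branch g q => if guard_test g syms then p.+1 else q
  | Jump q => q
  end.

Definition instr_move (i : instr) (k : nat) : move :=
  if i is Move m k' then (if k == k' then m else Stay) else Stay.

(** State [None] spends one step on writing the markers; afterwards every step writes back what it
    read, so only the heads move. Cell 0 of tapes 0 and 1 holds data and cannot carry a marker,
    hence the duplicate tapes for registers 0 and 1. *)
Definition machine : TM := {|
  work_tapes := K;
  aux := unit : finType;
  state := option 'I_rejecting.+1 : finType;
  start := None;
  verdict := fun q =>
    if q is Some p then
      if p == accepting :> nat then Some true
      else if p == rejecting :> nat then Some false else None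
    else None;
  delta := fun q syms =>
    if q is Some p then
      let i := nth (Jump 0) code p in
      (Some (inord (instr_next i p syms)),
       fun t : 'I_K.+2 => (syms t, instr_move i (tape_register t)))
    else
      (Some (inord 0),
       fun t : 'I_K.+2 => (if t < 2 then syms t else marker, Stay))
|}.

Section Run.
Variables x u : seq bool.

Definition machine_config (p : nat) (s : nat -> nat) : config machine :=
  @Config machine (Some (inord p)) (fun t => s (tape_register t))
    (fun t => if t == 0 :> nat then tape_of_word _ x
              else if t == 1 :> nat then tape_of_word _ u
              else fun i => if i == 0 then marker else None).

Lemma machine_start : step (init_config machine x u) = machine_config 0 (fun _ => 0).
Proof.
congr Config; apply: funext => t.
apply: funext => i; rewrite ffunE /=.
by case: (nat_of_ord t) => [|[|n]] //=; case: eqP => // ->.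
Qed.

Lemma tape_of_word_true w i :
  (tape_of_word unit w i == Some (inl true)) = nth false w i.
Proof.
rewrite /tape_of_word; have := odflt_onth false w i.
by case: (onth w i) => [[]|] /= <-.
Qed.

Lemma guard_testE p s g : instr_register (Branch g 0) < K ->
  guard_test g [ffun t => cell (machine_config p s) t (head_pos (machine_config p s) t)]
  = guard_holds x u g s.
Proof.
case: g => [k||| ] /= hk; rewrite ffunE /= inordK //.
- by case: (s k).
- by rewrite /= tape_of_word_true.
- by rewrite -onthTE /tape_of_word /= /tape_register /=; case: (onth x (s 0)).
- by rewrite /= tape_of_word_true.
Qed.

Lemma machine_step p s : p < size code ->
  let: (p', s') := instr_step x u (nth (Jump 0) code p) p s in
  step (machine_config p s) = machine_config p' s'.
Proof.
move=> hp; have hreg : instr_register (nth (Jump 0) code p) < K.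
  rewrite ltnS -(nth_map _ 0) //; apply: leq_bigmax_seq => //.
  by apply: mem_nth; rewrite size_map.
move: (hp); rewrite size_rcons ltnS => hpb.
have pE : @inord rejecting p = p :> nat by rewrite inordK // ltnS (leq_trans hpb) // /rejecting; lia.
rewrite /step /= pE ltn_eqF // ltn_eqF; last by rewrite /rejecting; lia.
set i := nth _ _ _ in hreg *.
have -> : (instr_step x u i p s) =
    (instr_next i p [ffun t => cell (machine_config p s) t (head_pos (machine_config p s) t)],
     fun k => move_head (instr_move i k) (s k)).
  case: i hreg => [m k|g q|q] /= hk.
  - by congr pair; apply: funext => j; rewrite /upd; case: eqP => // ->.
  - by rewrite guard_testE.
  - by [].
congr Config; apply: funext => t; apply: funext => j.
by rewrite ffunE /=; case: eqP => // ->.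
Qed.

Definition code_at (p : nat) (l : seq instr) : Prop :=
  exists l1 l2, code = l1 ++ l ++ l2 /\ size l1 = p.

Lemma code_at_cat p l1 l2 :
  code_at p (l1 ++ l2) -> code_at p l1 /\ code_at (p + size l1) l2.
Proof.
case=> [c1 [c2 [cE <-]]]; rewrite -catA in cE; split; first by exists c1, (l2 ++ c2).
by exists (c1 ++ l1), c2; rewrite cE -catA size_cat.
Qed.

Lemma code_at_step p i l s : code_at p (i :: l) ->
  let: (p', s') := instr_step x u i p s in
  step (machine_config p s) = machine_config p' s'.
Proof.
case=> [c1 [c2 [cE <-]]]; have := @machine_step (size c1) s.
by rewrite cE size_cat nth_cat ltnn subnn /= -ltn_subLR // subnn; apply.
Qed.

Lemma code_at_tail p i l : code_at p (i :: l) -> code_at p.+1 l.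
Proof. by rewrite -cat1s => /code_at_cat[_]; rewrite addn1. Qed.

Lemma exec_machine c' s t s' p : exec x u c' s t s' -> code_at p (compile p c') ->
  iter t (@step machine) (machine_config p s) =
  machine_config (p + size (compile p c')) s'.
Proof.
move=> ex; elim: ex p => {c' s t s'}
  [m k s|c1 c2 s1 s2 s3 t1 t2 _ IH1 _ IH2|g c' s s' t gs _ IH|g c' s gs
  |g c' s1 s2 s3 t1 t2 gs _ IH1 _ IH2|g c' s gs] p hp /=.
- by have /= -> := code_at_step s hp; rewrite addn1.
- move: hp => /= /code_at_cat[h1 h2].
  by rewrite addnC iterD IH1 // IH2 // size_cat addnA.
- rewrite -iterS iterSr; have /= := code_at_step s hp; rewrite gs => ->.
  by rewrite IH ?addSnnS //; apply: code_at_tail hp.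
- have /= := code_at_step s hp; rewrite (negbTE gs) => ->.
  by rewrite addnS.
- rewrite -!iterS.
  have h1 := code_at_tail hp; rewrite -cats1 in h1; have [h2 h3] := code_at_cat h1.
  have -> : (t1 + t2).+2 = t2 + (t1.+1).+1 by lia.
  rewrite iterD iterS iterSr; have /= := code_at_step s1 hp; rewrite gs => ->.
  rewrite IH1 //; have /= -> := code_at_step s2 h3.
  by rewrite IH2.
- have /= := code_at_step s hp; rewrite (negbTE gs) => ->.
  by rewrite size_rcons !addnS.
Qed.

(** The two extra steps are the writing of the markers and the final test of [res]. *)
Lemma machine_verdict t s : exec x u c (fun _ => 0) t s ->
  verdict_after machine x u t.+2 = Some (s res != 0).
Proof.
move=> ex; rewrite /verdict_after -addn1 -[t.+1]addn1 -addnA addnC !iterD /=.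
rewrite -iterS iterSr machine_start.
rewrite (exec_machine ex); last by exists [::], [:: Branch (Nonzero res) (size body).+2]; rewrite cats1.
rewrite add0n.
have /(code_at_step s) /= -> : code_at (size body) [:: Branch (Nonzero res) rejecting].
  by exists body, [::]; rewrite cats0 cats1.
rewrite /= inordK; last by case: ifP => _; rewrite ltnS /rejecting.
by case: (s res) => [|n] /=; rewrite ?eqxx // gtn_eqF.
Qed.

End Run.
End Machine.

(** * Polynomial-time evaluation of terms *)

Section Runs.
Variables x u : seq bool.

Definition runs (c : cmd) (s : nat -> nat) (T : nat) (s' : nat -> nat) : Prop :=
  exists2 t, t <= T & exec x u c s t s'.

Lemma runs_eq c s T1 T2 s1 s2 :
  runs c s T1 s1 -> T1 <= T2 -> s1 =1 s2 -> runs c s T2 s2.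
Proof. by case=> t ht ex hT /funext <-; exists t => //; apply: leq_trans hT. Qed.

Lemma runs_shift m k s : runs (Shift m k) s 1 (upd s k (move_head m (s k))).
Proof. by exists 1 => //; constructor. Qed.

Lemma runs_seq c1 c2 s1 s2 s3 T1 T2 :
  runs c1 s1 T1 s2 -> runs c2 s2 T2 s3 -> runs (Seq c1 c2) s1 (T1 + T2) s3.
Proof.
move=> [t1 h1 e1] [t2 h2 e2]; exists (t1 + t2); first exact: leq_add.
exact: ExecSeq e1 e2.
Qed.

Lemma runs_if g c s T s' : (guard_holds x u g s -> runs c s T s') ->
  runs (If g c) s T.+1 (if guard_holds x u g s then s' else s).
Proof.
case: (boolP (guard_holds x u g s)) => [gs /(_ isT)[t ht e]|gs _].
  by exists t.+1 => //; apply: ExecIfTrue.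
by exists 1 => //; apply: ExecIfFalse.
Qed.

(** Each round costs a test and a jump besides its body, and one last test leaves the loop. *)
Lemma runs_while g c (st : nat -> nat -> nat) m T :
    (forall j, j < m -> guard_holds x u g (st j) /\ runs c (st j) T (st j.+1)) ->
    ~~ guard_holds x u g (st m) ->
  runs (While g c) (st 0) (m * T.+2).+1 (st m).
Proof.
elim: m st => [|m IHm] st hst hm; first by exists 1 => //; apply: ExecWhileFalse.
have [g0 [t0 h0 e0]] := hst 0 isT.
have [j hj|//|t ht e] := IHm (fun j => st j.+1); first exact: hst.
by exists (t0 + t).+2; [rewrite mulSn; lia|apply: ExecWhileTrue e].
Qed.

End Runs.

Ltac upd_lia :=
  rewrite /upd /=;
  repeat match goal with
  | |- context [if ?a == ?b then _ else _] => case: (eqVneq a b) => ? /=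
  end; subst; try lia.

Definition clear a := While (Nonzero a) (Shift MoveLeft a).

Definition transfer a b :=
  While (Nonzero a) (Seq (Shift MoveLeft a) (Shift MoveRight b)).

(** A register is read by counting it down, so a second copy is collected in [f] and moved back. *)
Definition copy a k f :=
  Seq (While (Nonzero a)
         (Seq (Shift MoveLeft a) (Seq (Shift MoveRight k) (Shift MoveRight f))))
      (transfer f a).

Section Basic.
Variables x u : seq bool.

Lemma runs_clear a s : runs x u (clear a) s (3 * s a).+1 (upd s a 0).
Proof.
apply: (runs_eq (s1 := upd s a (s a - s a)) (T1 := (s a * 3).+1)).
- have := @runs_while x u (Nonzero a) (Shift MoveLeft a) (fun j => upd s a (s a - j)) (s a) 1.
  have -> : upd s a (s a - 0) = s by apply: funext => i; upd_lia.
  apply; last by upd_lia.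
  move=> j hj; split; first by upd_lia.
  by apply: runs_eq (runs_shift _ _ _ _ _) _ _ => // i; upd_lia.
- lia.
- by move=> i; upd_lia.
Qed.

Lemma runs_transfer a b s : a != b ->
  runs x u (transfer a b) s (4 * s a).+1 (upd (upd s a 0) b (s b + s a)).
Proof.
move=> ab.
pose st j := upd (upd s a (s a - j)) b (s b + j).
have e0 : st 0 = s by apply: funext => i; rewrite /st; upd_lia.
rewrite -[in runs _ _ _ s]e0 {e0}.
apply: (runs_eq (s1 := st (s a)) (T1 := (s a * 4).+1)).
- apply: runs_while => [j hj|]; last by rewrite /st; upd_lia.
  split; first by rewrite /st; upd_lia.
  apply: runs_eq (runs_seq (runs_shift _ _ _ _ _) (runs_shift _ _ _ _ _)) _ _ => // i.
  by rewrite /st; upd_lia.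
- lia.
- by move=> i; rewrite /st; upd_lia.
Qed.

Lemma runs_copy a k f s : a != k -> a != f -> k != f -> s f = 0 ->
  runs x u (copy a k f) s (9 * s a + 2) (upd s k (s k + s a)).
Proof.
move=> ak af kf sf.
pose st j := upd (upd (upd s a (s a - j)) k (s k + j)) f j.
have e0 : st 0 = s by apply: funext => i; rewrite /st; upd_lia.
rewrite -[in runs _ _ _ s]e0 {e0}.
have fa : f != a by rewrite eq_sym.
apply: runs_eq (runs_seq (runs_while (m := s a) (T := 3) _ _) (runs_transfer _ fa)) _ _.
- move=> j hj; split; first by rewrite /st; upd_lia.
  apply: runs_eq (runs_seq (runs_shift _ _ _ _ _)
    (runs_seq (runs_shift _ _ _ _ _) (runs_shift _ _ _ _ _))) _ _ => // i.
  by rewrite /st; upd_lia.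
- by rewrite /st; upd_lia.
- have -> : st (s a) f = s a by rewrite /st; upd_lia.
  lia.
- by move=> i; rewrite /st; upd_lia.
Qed.

End Basic.

Inductive term :=
  | TVar of nat
  | TOne
  | TAdd of term & term
  | TMul of term & term
  | TSub of term & term
  | TSum of nat & term & term
  | TInput of term
  | TCert of term
  | TSize.

Fixpoint eval (x u : seq bool) (env : nat -> nat) (t : term) : nat :=
  match t with
  | TVar i => env i
  | TOne => 1
  | TAdd a b => eval x u env a + eval x u env b
  | TMul a b => eval x u env a * eval x u env b
  | TSub a b => eval x u env a - eval x u env b
  | TSum i b a => \sum_(j < eval x u env b) eval x u (upd env i j) a
  | TInput a => nth false x (eval x u env a)
  | TCert a => nth false u (eval x u env a)
  | TSize => size x
  end.

(* Adds the value of the term to register [k]; variable [i] is in register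
   [rho i], and the registers from [f] on are used as scratch space. *)
Fixpoint evaluator (rho : nat -> nat) (k f : nat) (t : term) : cmd :=
  match t with
  | TVar i => copy (rho i) k f
  | TOne => Shift MoveRight k
  | TAdd a b => Seq (evaluator rho k f a) (evaluator rho k f b)
  | TMul a b => Seq (evaluator rho f f.+1 a)
      (While (Nonzero f) (Seq (Shift MoveLeft f) (evaluator rho k f.+1 b)))
  | TSub a b => Seq (evaluator rho f f.+1 a) (Seq (evaluator rho f.+1 f.+2 b)
      (Seq (While (Nonzero f.+1) (Seq (Shift MoveLeft f.+1) (Shift MoveLeft f)))
         (transfer f k)))
  | TSum i b a => Seq (evaluator rho f f.+1 b)
      (Seq (While (Nonzero f)
              (Seq (Shift MoveLeft f)
                 (Seq (evaluator (upd rho i f.+1) k f.+2 a)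
                    (Shift MoveRight f.+1))))
         (clear f.+1))
  | TInput a => Seq (evaluator rho f f.+1 a) (Seq (transfer f 0)
      (Seq (If InputTrue (Shift MoveRight k)) (clear 0)))
  | TCert a => Seq (evaluator rho f f.+1 a) (Seq (transfer f 1)
      (Seq (If CertTrue (Shift MoveRight k)) (clear 1)))
  | TSize => Seq
      (While InputDefined (Seq (Shift MoveRight 0) (Shift MoveRight k)))
      (clear 0)
  end.

(** Registers 0 and 1 must be zero because reading a bit uses them as head positions; [k] is kept
    apart from the variables so that accumulating leaves their values alone. *)
Record ready (rho : nat -> nat) (k f : nat) (s : nat -> nat) (m : nat) : Prop :=
  Ready {
    ready_acc : 1 < k < f;
    ready_vars : forall i, [&& 1 < rho i, rho i < f & rho i != k];
    ready_zero : forall j, (j < 2) || (f <= j) -> s j = 0;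
    ready_bound : forall i, s (rho i) <= m
  }.

Lemma ready_inner rho k k' f f' s m : ready rho k f s m ->
  f <= k' < f' -> ready rho k' f' s m.
Proof.
move=> [kf hv h0 hb] kf'; split=> //; first by lia.
- by move=> i; have := hv i; lia.
- by move=> j hj; apply: h0; lia.
Qed.

Lemma ready_upd rho k f s m v : ready rho k f s m -> ready rho k f (upd s k v) m.
Proof.
move=> [kf hv h0 hb]; split=> //.
- by move=> j hj; have := h0 j; upd_lia; apply.
- by move=> i; have := hv i; have := hb i; upd_lia.
Qed.

Lemma env_upd rho k f s m v : ready rho k f s m -> upd s k v \o rho = s \o rho.
Proof.
by move=> [kf hv h0 hb]; apply: funext => i /=; have := hv i; upd_lia.
Qed.

(* In the inductive steps every time bound is at most a small power of two times
   the product of the bounds of the subterms. *)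
Lemma pow_bound n m da db e : n <= 2 ^ e * ((m + 2) ^ da * (m + 2) ^ db) ->
  n <= (m + 2) ^ (da + db + e).
Proof.
move=> hn; apply: (leq_trans hn); rewrite mulnC !expnD leq_mul2l.
by case: e {hn} => [|e]; rewrite ?orbT // leq_exp2r // addn2 orbT.
Qed.

(** The degree depends on the term alone, and [m] does not involve the certificate. As [m + 2] is at
    least 2, constant factors can be absorbed into powers of it. *)
Definition evaluates (t : term) (d : nat) : Prop := forall x u m rho k f s,
    size x <= m -> ready rho k f s m ->
    let v := eval x u (s \o rho) t in
  v <= (m + 2) ^ d /\
  runs x u (evaluator rho k f t) s ((m + 2) ^ d) (upd s k (s k + v)).

Lemma pow_gt0 m d : 0 < (m + 2) ^ d. Proof. by rewrite expn_gt0 addn2. Qed.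

Lemma pow_linear m d : (m + 2) * 2 ^ d <= (m + 2) ^ d.+1.
Proof. by rewrite expnS leq_mul2l addn2 /=; case: d => // d; rewrite leq_exp2r. Qed.

Lemma evaluates_var i : evaluates (TVar i) 5.
Proof.
move=> x u m rho k f s _ [kf hv h0 hb] /=.
(* Copying takes at most [9 * m + 2] steps, which is below [(m + 2) * 2 ^ 4]. *)
have := pow_linear m 4; have := hb i; have := hv i => hvi hbi p4.
split; first by lia.
apply: runs_eq (runs_copy _ _ _ _ _ _) _ _ => //; try lia.
by apply: h0; lia.
Qed.

Lemma evaluates_one : evaluates TOne 0.
Proof.
move=> x u m rho k f s _ _ /=; split=> //.
by apply: runs_eq (runs_shift _ _ _ _ _) _ _ => // i; upd_lia.
Qed.

Lemma evaluates_size : evaluates TSize 4.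
Proof.
move=> x u m rho k f s sx [kf hv h0 hb] /=.
have p3 := pow_linear m 3; have s0 : s 0 = 0 by apply: h0.
split; first by lia.
pose st j := upd (upd s 0 j) k (s k + j).
have e0 : st 0 = s by apply: funext => i; rewrite /st; upd_lia.
rewrite -[in runs _ _ _ s]e0.
apply: runs_eq (runs_seq (runs_while (m := size x) (T := 2) _ _) (runs_clear _ _ 0 _)) _ _.
- move=> j hj; split; first by rewrite /st {e0}; upd_lia.
  apply: runs_eq (runs_seq (runs_shift _ _ _ _ _) (runs_shift _ _ _ _ _)) _ _ => // i.
  by rewrite /st {e0}; upd_lia.
- by rewrite /st {e0}; upd_lia.
- have -> : st (size x) 0 = size x by rewrite /st {e0}; upd_lia.
  lia.
- by move=> i; rewrite /st {e0}; upd_lia.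
Qed.

Lemma evaluates_add a b da db :
  evaluates a da -> evaluates b db -> evaluates (TAdd a b) (da + db + 1).
Proof.
move=> IHa IHb x u m rho k f s sx rd /=.
have [va ra] := IHa x u m rho k f s sx rd.
have rd' := ready_upd (s k + eval x u (s \o rho) a) rd.
have [] := IHb x u m rho k f _ sx rd'; rewrite (env_upd _ rd) => vb rb.
have pa := pow_gt0 m da; have pb := pow_gt0 m db.
split; first by apply: pow_bound; nia.
apply: runs_eq (runs_seq ra rb) _ _; first by apply: pow_bound; nia.
by move=> i; upd_lia.
Qed.

Lemma evaluates_mul a b da db :
  evaluates a da -> evaluates b db -> evaluates (TMul a b) (da + db + 3).
Proof.
move=> IHa IHb x u m rho k f s sx rd /=.
have pa := pow_gt0 m da; have pb := pow_gt0 m db.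
have [kf hv h0 hb] := rd.
have [|va ra] := IHa x u m rho f f.+1 s sx; first by apply: (ready_inner rd); lia.
have sf : s f = 0 by apply: h0; lia.
set w := eval x u _ a in va ra *; rewrite sf add0n in ra.
pose v := eval x u (s \o rho) b; rewrite -/v.
pose st j := upd (upd s f (w - j)) k (s k + j * v).
have runb j : let s' := upd (st j) f (w - j.+1) in v <= (m + 2) ^ db /\
    runs x u (evaluator rho k f.+1 b) s' ((m + 2) ^ db) (upd s' k (s' k + v)).
  have <- : eval x u (upd (st j) f (w - j.+1) \o rho) b = v.
    congr eval; apply: funext => i /=; have := hv i; rewrite /st; upd_lia.
  apply: IHb => //; split=> [|i|i hi|i]; first by lia.
  - by have := hv i; lia.
  - by have := h0 i; rewrite /st; upd_lia; apply; lia.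
  - by have := hv i; have := hb i; rewrite /st; upd_lia.
have [vb _] := runb 0.
split; first by apply: pow_bound; nia.
have e0 : upd s f w = st 0 by apply: funext => i; rewrite /st; upd_lia.
rewrite e0 {e0} in ra.
apply: runs_eq (runs_seq ra (runs_while (m := w) (T := 1 + (m + 2) ^ db) _ _)) _ _.
- move=> j hj; split; first by rewrite /st; upd_lia.
  have [_ rb] := runb j.
  apply: runs_eq (runs_seq (runs_shift _ _ _ _ _) _) (leqnn _) _.
    rewrite [X in upd _ _ X](_ : _ = w - j.+1); last by rewrite /st; upd_lia.
    exact: rb.
  by move=> i; rewrite /st mulSn; upd_lia.
- by rewrite /st; upd_lia.
- apply: pow_bound.
  have : w * (1 + (m + 2) ^ db).+2 <= (m + 2) ^ da * (1 + (m + 2) ^ db).+2.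
    by rewrite leq_mul2r va orbT.
  nia.
- by move=> i; rewrite /st; upd_lia.
Qed.

Lemma evaluates_sub a b da db :
  evaluates a da -> evaluates b db -> evaluates (TSub a b) (da + db + 4).
Proof.
move=> IHa IHb x u m rho k f s sx rd /=.
have pa := pow_gt0 m da; have pb := pow_gt0 m db.
have [kf hv h0 hb] := rd.
have rdf : ready rho f f.+1 s m by apply: (ready_inner rd); lia.
have [va ra] := IHa x u m rho f f.+1 s sx rdf.
have sf : s f = 0 by apply: h0; lia.
have sf1 : s f.+1 = 0 by apply: h0; lia.
set w := eval x u _ a in va ra *; rewrite sf add0n in ra.
have [|] := IHb x u m rho f.+1 f.+2 (upd s f w) sx.
  by apply: (ready_inner (ready_upd w rdf)); lia.
rewrite (env_upd _ rdf); set v := eval x u _ b => vb rb.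
split; first by apply: pow_bound; nia.
(* A left move at 0 stays there, so counting [f] down [v] times gives truncated subtraction. *)
pose st j := upd (upd s f (w - j)) f.+1 (v - j).
rewrite (_ : upd _ f.+1 _ = st 0) in rb; last by apply: funext => i; rewrite /st; upd_lia.
have fk : f != k by lia.
apply: runs_eq (runs_seq ra (runs_seq rb
  (runs_seq (runs_while (m := v) (T := 2) _ _) (runs_transfer _ _ _ fk)))) _ _.
- move=> j hj; split; first by rewrite /st; upd_lia.
  apply: runs_eq (runs_seq (runs_shift _ _ _ _ _) (runs_shift _ _ _ _ _)) _ _ => // i.
  by rewrite /st; upd_lia.
- by rewrite /st; upd_lia.
- rewrite {1}/st; apply: pow_bound.
  have -> : upd (upd s f (w - v)) f.+1 (v - v) f = w - v by upd_lia.
  nia.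
- by move=> i; rewrite /st; upd_lia.
Qed.

(* The loop body may see values of the bound variable up to the value of [b],
   so it runs with [m] replaced by [(m + 2) ^ db.+1]. *)
Lemma evaluates_sum i b a da db :
  evaluates b db -> evaluates a da -> evaluates (TSum i b a) (db + (db + 3) * da + 4).
Proof.
move=> IHb IHa x u m rho k f s sx rd /=.
have pb := pow_gt0 m db; have pa := pow_gt0 m ((db + 3) * da).
have [kf hv h0 hb] := rd.
have [|vb rb] := IHb x u m rho f f.+1 s sx; first by apply: (ready_inner rd); lia.
have sf : s f = 0 by apply: h0; lia.
set w := eval x u _ b in vb rb *; rewrite sf add0n in rb.
pose v j := eval x u (upd (s \o rho) i j) a.
pose st j := upd (upd (upd s f (w - j)) f.+1 j) k (s k + \sum_(j' < j) v j').
(* One power above the bound on [w] also dominates [m]; two further powers absorb the [+ 2], whence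
   [db + 3]. *)
pose m' := (m + 2) ^ db.+1.
have m'P : (m' + 2) ^ da <= (m + 2) ^ ((db + 3) * da).
  rewrite expnM; case: (da) => // d; rewrite leq_exp2r // /m' addn3 (expnS _ db.+2) (expnS _ db.+1).
  have := pow_gt0 m db.+1; nia.
have mm' : m <= m' by rewrite /m' expnS; nia.
have wm' : w <= m' by rewrite /m' expnS; nia.
have runa j : j < w -> let s' := upd (st j) f (w - j.+1) in v j <= (m' + 2) ^ da /\
    runs x u (evaluator (upd rho i f.+1) k f.+2 a) s' ((m' + 2) ^ da) (upd s' k (s' k + v j)).
  move=> hj; rewrite /v.
  have -> : upd (s \o rho) i j = upd (st j) f (w - j.+1) \o upd rho i f.+1.
    apply: funext => i' /=; have := hv i'; rewrite {2}/upd; case: (i' == i); rewrite /st; upd_lia.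
  apply: IHa => //; first exact: leq_trans mm'.
  split=> [|i'|i' hi|i']; first by lia.
  - by have := hv i'; upd_lia.
  - by have := h0 i'; rewrite /st; upd_lia; apply; lia.
  - have := hv i'; have := hb i'; rewrite [upd rho i _ i']/upd.
    by case: (i' == i); rewrite /st; upd_lia.
have vj j : j < w -> v j <= (m + 2) ^ ((db + 3) * da).
  by move=> /runa[vj _]; apply: leq_trans m'P.
have vsum : \sum_(j < w) v j <= w * (m + 2) ^ ((db + 3) * da).
  rewrite -[w in w * _]card_ord -sum_nat_const; apply: leq_sum => j _.
  exact: vj.
have wP : w * (m + 2) ^ ((db + 3) * da) <= (m + 2) ^ db * (m + 2) ^ ((db + 3) * da).
  by rewrite leq_mul2r vb orbT.
rewrite -![\sum_(j < w) _]/(\sum_(j < w) v j).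
split; first by apply: pow_bound; nia.
have e0 : upd s f w = st 0.
  by apply: funext => j; rewrite /st big_ord0; have := h0 f.+1; upd_lia; move->; lia.
rewrite e0 {e0} in rb.
apply: runs_eq (runs_seq rb (runs_seq
  (runs_while (m := w) (T := 1 + ((m + 2) ^ ((db + 3) * da) + 1)) _ _)
  (runs_clear _ _ _ _))) _ _.
- move=> j hj; split; first by rewrite /st; upd_lia.
  have [_ ra] := runa j hj.
  apply: runs_eq (runs_seq (runs_shift _ _ _ _ _)
    (runs_seq (s2 := upd (upd (st j) f (w - j.+1)) k (s k + \sum_(j' < j.+1) v j'))
       (T1 := (m' + 2) ^ da) _ (runs_shift _ _ _ _ _))) _ _.
  + rewrite [move_head _ _](_ : _ = w - j.+1); last by rewrite /st; upd_lia.
    apply: runs_eq ra (leqnn _) _ => i'.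
    by rewrite big_ord_recr /= /st; upd_lia.
  + by rewrite !leq_add2l leq_add2r.
  + by move=> i'; rewrite /st; upd_lia.
- by rewrite /st; upd_lia.
- apply: pow_bound.
  have -> : st w f.+1 = w by rewrite /st; upd_lia.
  nia.
- by move=> i'; rewrite /st; have := h0 f; have := h0 f.+1; upd_lia.
Qed.

Lemma evaluates_input a da : evaluates a da -> evaluates (TInput a) (da + 5).
Proof.
move=> IHa x u m rho k f s sx rd /=.
have pa := pow_gt0 m da; have [kf hv h0 hb] := rd.
have [|va ra] := IHa x u m rho f f.+1 s sx; first by apply: (ready_inner rd); lia.
have sf : s f = 0 by apply: h0; lia.
have s0 : s 0 = 0 by apply: h0.
set w := eval x u _ a in va ra *; rewrite sf add0n in ra.
have p5 : 32 * (m + 2) ^ da <= (m + 2) ^ (da + 5).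
  by rewrite mulnC expnD leq_mul2l -[32]/(2 ^ 5) leq_exp2r // addn2 orbT.
split; first by case: (nth _ _ _); lia.
have f0 : f != 0 by lia.
have rt : runs x u (transfer f 0) (upd s f w) (4 * w).+1 (upd s 0 w).
  apply: runs_eq (runs_transfer _ _ _ f0) _ _; first by upd_lia.
  by move=> j; upd_lia.
apply: runs_eq (runs_seq ra (runs_seq rt
  (runs_seq (runs_if (fun _ => runs_shift _ _ _ _ _)) (runs_clear _ _ _ _)))) _ _.
- by rewrite /=; case: ifP => _; upd_lia.
- by move=> j; rewrite /= {1}/upd /=; case: (nth false x w) => /=; upd_lia.
Qed.

Lemma evaluates_cert a da : evaluates a da -> evaluates (TCert a) (da + 5).
Proof.
move=> IHa x u m rho k f s sx rd /=.
have pa := pow_gt0 m da; have [kf hv h0 hb] := rd.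
have [|va ra] := IHa x u m rho f f.+1 s sx; first by apply: (ready_inner rd); lia.
have sf : s f = 0 by apply: h0; lia.
have s1 : s 1 = 0 by apply: h0.
set w := eval x u _ a in va ra *; rewrite sf add0n in ra.
have p5 : 32 * (m + 2) ^ da <= (m + 2) ^ (da + 5).
  by rewrite mulnC expnD leq_mul2l -[32]/(2 ^ 5) leq_exp2r // addn2 orbT.
split; first by case: (nth _ _ _); lia.
have f1 : f != 1 by lia.
have rt : runs x u (transfer f 1) (upd s f w) (4 * w).+1 (upd s 1 w).
  apply: runs_eq (runs_transfer _ _ _ f1) _ _; first by upd_lia.
  by move=> j; upd_lia.
apply: runs_eq (runs_seq ra (runs_seq rt
  (runs_seq (runs_if (fun _ => runs_shift _ _ _ _ _)) (runs_clear _ _ _ _)))) _ _.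
- by rewrite /=; case: ifP => _; upd_lia.
- by move=> j; rewrite /= {1}/upd /=; case: (nth false u w) => /=; upd_lia.
Qed.

Lemma evaluator_correct t : exists d, evaluates t d.
Proof.
elim: t => [i||a [da IHa] b [db IHb]|a [da IHa] b [db IHb]|a [da IHa] b [db IHb]
  |i b [db IHb] a [da IHa]|a [da IHa]|a [da IHa]|].
- by exists 5; apply: evaluates_var.
- by exists 0; apply: evaluates_one.
- by exists (da + db + 1); apply: evaluates_add.
- by exists (da + db + 3); apply: evaluates_mul.
- by exists (da + db + 4); apply: evaluates_sub.
- by exists (db + (db + 3) * da + 4); apply: evaluates_sum.
- by exists (da + 5); apply: evaluates_input.
- by exists (da + 5); apply: evaluates_cert.
- by exists 4; apply: evaluates_size.
Qed.

(** All variables initially share register 2, which holds 0; bound ones get their own register on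
    entering a sum. The result is collected in register 3. *)
Definition term_machine (t : term) : TM := machine (evaluator (fun _ => 2) 3 4 t) 3.

Lemma term_machine_verdict t : exists d, forall x u, exists2 n, n <= (size x + 2) ^ d &
  verdict_after (term_machine t) x u n.+2 = Some (eval x u (fun _ => 0) t != 0).
Proof.
have [d Ed] := evaluator_correct t; exists d => x u.
have [|_ [n hn ex]] := Ed x u (size x) (fun _ => 2) 3 4 (fun _ => 0) (leqnn _); first by split.
by exists n => //; rewrite (machine_verdict 3 ex) /upd /= add0n.
Qed.

Lemma verdict_stable (M : TM) x u n n' b :
  n <= n' -> verdict_after M x u n = Some b -> verdict_after M x u n' = Some b.
Proof.
move=> /subnK <-; rewrite /verdict_after; elim: (n' - n) => // k IHk /IHk.
by rewrite addSn iterS; set c := iter _ _ _ => vc; rewrite /step vc.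
Qed.

Lemma term_machine_accepts t x u :
  accepts (term_machine t) x u <-> 0 < eval x u (fun _ => 0) t.
Proof.
have [d /(_ x u)[n _ vn]] := term_machine_verdict t; rewrite lt0n; split=> [[n' vn']|ev].
  have := verdict_stable (leq_maxl n' n.+2) vn'; rewrite (verdict_stable (leq_maxr n' n.+2) vn).
  by case.
by exists n.+2; rewrite vn ev.
Qed.

Lemma term_machine_poly t : polynomial_time (term_machine t).
Proof.
have [d Ed] := term_machine_verdict t; exists (3 ^ d + 2), d => x u.
have [n hn vn] := Ed x u; exists (eval x u (fun _ => 0) t != 0); rewrite /=.
apply: verdict_stable vn; set N := size x + size u.
(* For positive [N] one has [size x + 2 <= 3 * N]; the additive term covers [N = 0]. *)
have : (size x + 2) ^ d <= 3 ^ d * N ^ d + 3 ^ d.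
  have xN : size x <= N by rewrite leq_addr.
  case: d {Ed hn} => // d; case: N xN => [|N] xN.
    by apply: leq_trans (leq_addl _ _); rewrite leq_exp2r //; lia.
  apply: leq_trans (leq_addr _ _); rewrite -expnMn leq_exp2r //; lia.
move: hn; nia.
Qed.

Lemma NP_term (L : seq bool -> Prop) (t : term) (c d : nat) :
    (forall x, L x <-> exists2 u, size u <= c * size x ^ d + c &
       0 < eval x u (fun _ => 0) t) ->
  NP L.
Proof.
move=> Lt; exists (term_machine t), c, d; split; first exact: term_machine_poly.
move=> x; rewrite Lt; split=> -[u su]; first by exists u; rewrite ?term_machine_accepts.
by rewrite term_machine_accepts; exists u.
Qed.

(** * The verification formula *)

Definition TNot a := TSub TOne a.
Definition TImp a b := TNot (TMul a (TNot b)).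
Definition TEq a b := TNot (TAdd (TSub a b) (TSub b a)).
Definition TAll i b a := TNot (TSum i b (TNot a)).

Definition holds (x u : seq bool) (env : nat -> nat) (t : term) : bool :=
  0 < eval x u env t.

Lemma holds_not x u env a : holds x u env (TNot a) = ~~ holds x u env a.
Proof. by rewrite /holds /= subn_gt0 -leqNgt. Qed.

Lemma holds_mul x u env a b : holds x u env (TMul a b) = holds x u env a && holds x u env b.
Proof. by rewrite /holds /= muln_gt0. Qed.

Lemma holds_add x u env a b : holds x u env (TAdd a b) = holds x u env a || holds x u env b.
Proof. by rewrite /holds /= addn_gt0. Qed.

Lemma holds_imp x u env a b : holds x u env (TImp a b) = (holds x u env a ==> holds x u env b).
Proof. by rewrite holds_not holds_mul holds_not negb_and negbK implybE. Qed.

Lemma holds_eq x u env a b : holds x u env (TEq a b) = (eval x u env a == eval x u env b).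
Proof. by rewrite /holds /=; apply/idP/eqP; lia. Qed.

Lemma holds_input x u env a : holds x u env (TInput a) = nth false x (eval x u env a).
Proof. by rewrite /holds /= lt0b. Qed.

Lemma holds_cert x u env a : holds x u env (TCert a) = nth false u (eval x u env a).
Proof. by rewrite /holds /= lt0b. Qed.

Lemma holds_sum x u env i b a : holds x u env (TSum i b a) =
  [exists j : 'I_(eval x u env b), holds x u (upd env i j) a].
Proof.
rewrite /holds /= lt0n sum_nat_eq0 negb_forall; apply: eq_existsb => j.
by rewrite lt0n.
Qed.

Lemma holds_all x u env i b a : holds x u env (TAll i b a) =
  [forall j : 'I_(eval x u env b), holds x u (upd env i j) a].
Proof.
rewrite holds_not holds_sum negb_exists; apply: eq_forallb => j.
by rewrite holds_not negbK.
Qed.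

Definition holdsE :=
  (holds_imp, holds_eq, holds_input, holds_cert, holds_all, holds_sum, holds_not,
   holds_mul, holds_add).

Section Formula.

Let n := TVar 0.
Let E i j := TInput (TAdd (TAdd n TOne) (TAdd (TMul (TVar i) n) (TVar j))).
Let B i j := TCert (TAdd (TMul (TVar i) n) (TVar j)).
Let M i j := TCert (TAdd (TMul n n) (TAdd (TMul (TVar i) n) (TVar j))).
Let neq i j := TNot (TEq (TVar i) (TVar j)).

Definition formula_input :=
  TMul (TEq TSize (TAdd (TAdd n TOne) (TMul n n)))
    (TMul (TNot (TInput n)) (TAll 1 n (TInput (TVar 1)))).

Definition formula_refl := TAll 1 n (B 1 1).

Definition formula_edge :=
  let t := TMul (neq 1 2) (TMul (B 1 2) (B 2 1)) in
  TAll 1 n (TAll 2 n (TMul (TImp (E 1 2) t) (TImp t (E 1 2)))).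

Definition formula_ferrers :=
  TAll 1 n (TAll 2 n (TAll 3 n (TAll 4 n
    (TImp (B 1 4) (TImp (B 3 2) (TAdd (B 1 2) (B 3 4))))))).

Definition formula_pair :=
  TAll 1 n (TAll 2 n (TImp (M 1 2) (TMul (M 2 1) (neq 1 2)))).

Definition formula_fun :=
  TAll 1 n (TAll 2 n (TAll 3 n (TImp (M 1 2) (TImp (M 1 3) (TEq (TVar 2) (TVar 3)))))).

Definition formula_dom :=
  TAll 1 n (TSum 2 n (TSum 3 n (TMul (M 2 3)
    (TMul (B 1 2) (TMul (B 2 1) (TMul (B 1 3) (B 3 1))))))).

Definition formula_body :=
  TMul formula_input (TMul formula_refl (TMul formula_edge (TMul formula_ferrers
    (TMul formula_pair (TMul formula_fun formula_dom))))).

(** The number of vertices is guessed rather than decoded: it is below the length of the word, so an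
    outer sum finds it. *)
Definition formula := TSum 0 TSize formula_body.

End Formula.

Definition matrix_at (w : seq bool) (p n : nat) : rel 'I_n :=
  fun i j => nth false w (p + (i * n + j)).
Arguments matrix_at w p {n}.

Section Body.
Variables (x u : seq bool) (env : nat -> nat) (n : nat).
Let env0 := upd env 0 n.
Let E := @matrix_at x (n + 1) n.
Let B := @matrix_at u 0 n.
Let M := @matrix_at u (n * n) n.

Lemma holds_allP env' i b a :
  reflect (forall j : 'I_(eval x u env' b), holds x u (upd env' i j) a)
    (holds x u env' (TAll i b a)).
Proof. by rewrite holds_all; apply: forallP. Qed.

Lemma holds_sumP env' i b a :
  reflect (exists j : 'I_(eval x u env' b), holds x u (upd env' i j) a)
    (holds x u env' (TSum i b a)).
Proof. by rewrite holds_sum; apply: existsP. Qed.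

Lemma formula_inputP : reflect
  [/\ size x = n + 1 + n * n, ~~ nth false x n & forall i : 'I_n, nth false x i]
  (holds x u env0 formula_input).
Proof.
rewrite /formula_input !holds_mul holds_eq holds_not holds_input /=.
apply: (iffP and3P) => -[h1 h2 h3]; split=> //; try exact/eqP.
- by move=> i; have /holds_allP/(_ i) := h3; rewrite holds_input.
- by apply/holds_allP => i; rewrite holds_input; apply: h3.
Qed.

Lemma formula_reflP : reflect (forall a, B a a) (holds x u env0 formula_refl).
Proof.
by apply: (iffP (holds_allP _ _ _ _)) => h a; have := h a; rewrite holds_cert.
Qed.

Lemma formula_edgeP : reflect
  (forall a b, E a b = [&& a != b, B a b & B b a]) (holds x u env0 formula_edge).
Proof.
apply: (iffP (holds_allP _ _ _ _)) => h a.
  move=> b; have /holds_allP/(_ b) := h a; rewrite !holdsE.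
  by move=> /andP[/implyP h1 /implyP h2]; apply/idP/idP.
apply/holds_allP => b; rewrite !holdsE; have := h a b.
by rewrite /E /B /matrix_at => ->; rewrite implybb.
Qed.

Lemma formula_ferrersP : reflect
  (forall a b c d, B a d -> B c b -> B a b || B c d) (holds x u env0 formula_ferrers).
Proof.
apply: (iffP (holds_allP _ _ _ _)) => h a.
  move=> b c d; have /holds_allP/(_ b)/holds_allP/(_ c)/holds_allP/(_ d) := h a.
  by rewrite !holdsE => /implyP h1 /h1/implyP.
apply/holds_allP => b; apply/holds_allP => c; apply/holds_allP => d.
by rewrite !holdsE; apply/implyP => h1; apply/implyP; apply: h h1.
Qed.

Lemma formula_pairP : reflect
  (forall a b, M a b -> M b a && (a != b)) (holds x u env0 formula_pair).
Proof.
apply: (iffP (holds_allP _ _ _ _)) => h a.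
  by move=> b; have /holds_allP/(_ b) := h a; rewrite !holdsE => /implyP.
by apply/holds_allP => b; rewrite !holdsE; apply/implyP; apply: h.
Qed.

Lemma formula_funP : reflect
  (forall a b c, M a b -> M a c -> b = c) (holds x u env0 formula_fun).
Proof.
apply: (iffP (holds_allP _ _ _ _)) => h a.
  move=> b c; have /holds_allP/(_ b)/holds_allP/(_ c) := h a.
  by rewrite !holdsE => /implyP h1 /h1/implyP h2 /h2/eqP/val_inj.
apply/holds_allP => b; apply/holds_allP => c; rewrite !holdsE.
by apply/implyP => h1; apply/implyP => h2; apply/eqP; rewrite /= (h a b c).
Qed.

Lemma formula_domP : reflect
  (forall v, exists a b, [&& M a b, B v a, B a v, B v b & B b v])
  (holds x u env0 formula_dom).
Proof.
apply: (iffP (holds_allP _ _ _ _)) => h v.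
  have /holds_sumP[a /holds_sumP[b]] := h v.
  by rewrite !holdsE; exists a, b.
have [a [b hab]] := h v.
by apply/holds_sumP; exists a; apply/holds_sumP; exists b; rewrite !holdsE.
Qed.

Lemma formula_bodyP : reflect
  [/\ size x = n + 1 + n * n, ~~ nth false x n, forall i : 'I_n, nth false x i &
      certifies E B M]
  (holds x u env0 formula_body).
Proof.
rewrite /formula_body (holds_mul _ _ _ formula_input) (holds_mul _ _ _ formula_refl).
rewrite (holds_mul _ _ _ formula_edge) (holds_mul _ _ _ formula_ferrers).
rewrite (holds_mul _ _ _ formula_pair) (holds_mul _ _ _ formula_fun).
apply: (iffP idP).
  case/and5P=> /formula_inputP[h1 h2 h3] /formula_reflP h4 /formula_edgeP h5.
  by move=> /formula_ferrersP h6 /and3P[/formula_pairP h7 /formula_funP h8 /formula_domP h9].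
case=> h1 h2 h3 [h4 h5 h6 h7 h8 h9].
apply/and5P; split; last apply/and3P; [exact/formula_inputP|exact/formula_reflP
 |exact/formula_edgeP|exact/formula_ferrersP|split;
 [exact/formula_pairP|exact/formula_funP|exact/formula_domP]].
Qed.

End Body.

(** * Words as graph encodings *)

Lemma nth_allpairs (S T R : Type) (f : S -> T -> R) x0 y0 z0 s t i j :
    i < size s -> j < size t ->
  nth z0 [seq f x y | x <- s, y <- t] (i * size t + j) = f (nth x0 s i) (nth y0 t j).
Proof.
elim: s i => // a s IHs [|i] hi hj; rewrite allpairs_cons nth_cat size_map.
  by rewrite mul0n add0n hj (nth_map y0).
by rewrite mulSn -addnA ltnNge leq_addr /= addKn IHs.
Qed.

Definition rel_bits (n : nat) (e : rel 'I_n) : seq bool :=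
  [seq e i j | i <- enum 'I_n, j <- enum 'I_n].

Lemma size_rel_bits n (e : rel 'I_n) : size (rel_bits e) = n * n.
Proof. by rewrite size_allpairs size_enum_ord. Qed.

Lemma nth_rel_bits n (e : rel 'I_n) (i j : 'I_n) : nth false (rel_bits e) (i * n + j) = e i j.
Proof.
have := @nth_allpairs _ _ _ e i j false (enum 'I_n) (enum 'I_n) i j.
by rewrite size_enum_ord !nth_ord_enum => ->.
Qed.

Lemma ltn_rel_bits_index n (i j : 'I_n) : i * n + j < n * n.
Proof. by have := ltn_ord i; have := ltn_ord j; nia. Qed.

Lemma size_encode_graph n (e : rel 'I_n) : size (encode_graph e) = n + 1 + n * n.
Proof. by rewrite size_cat size_nseq /= size_rel_bits addn1 addSnnS. Qed.

Lemma nth_encode_graph_unary n (e : rel 'I_n) i :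
  i <= n -> nth false (encode_graph e) i = (i < n).
Proof.
rewrite nth_cat size_nseq nth_nseq; case: ltnP => // ni hi.
by rewrite (_ : i = n) ?subnn; last lia.
Qed.

Lemma matrix_at_encode_graph n (e : rel 'I_n) : matrix_at (encode_graph e) (n + 1) = e.
Proof.
apply: funext => i; apply: funext => j; rewrite /matrix_at nth_cat size_nseq.
by rewrite ltnNge -addnA leq_addr /= addKn /= nth_rel_bits.
Qed.

Lemma encode_graph_matrix_at (x : seq bool) n :
    size x = n + 1 + n * n -> ~~ nth false x n -> (forall i : 'I_n, nth false x i) ->
  x = encode_graph (@matrix_at x (n + 1) n).
Proof.
move=> sx xn xi; apply: (@eq_from_nth _ false); first by rewrite size_encode_graph.
move=> k hk; case: (leqP k n) => kn.
  rewrite nth_encode_graph_unary //; move: kn; rewrite leq_eqVlt => /predU1P[->|kn].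
    by rewrite ltnn (negbTE xn).
  by rewrite kn (xi (Ordinal kn)).
have n0 : 0 < n by rewrite sx in hk; nia.
(* Past the [n] ones and the separator, [q] is the row-major index of row [q %/ n] and column
   [q %% n]. *)
pose q := k - (n + 1).
have hq : q < n * n by rewrite sx in hk; rewrite /q; lia.
have hi : q %/ n < n by rewrite ltn_divLR.
have hj : q %% n < n by rewrite ltn_mod.
have := congr1 (fun e => e (Ordinal hi) (Ordinal hj))
  (matrix_at_encode_graph (@matrix_at x (n + 1) n)).
rewrite /matrix_at /= -divn_eq.
by have -> : n + 1 + q = k by rewrite /q; lia.
Qed.

Theorem corollary4p16 (R : realType) : NP (interval_outcome_D R).
Proof.
(* Two matrices of [n * n] bits take at most twice the length of the encoding. *)
apply: (@NP_term _ formula 2 1) => x; split.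
  case=> n [e [se ie oe ->]].
  have [B [M cBM]] := certifies_exists ie oe.
  exists (rel_bits B ++ rel_bits M).
    by rewrite size_cat !size_rel_bits size_encode_graph expn1; lia.
  have nx : n < size (encode_graph e) by rewrite size_encode_graph; lia.
  apply/holds_sumP; exists (Ordinal nx); apply/formula_bodyP; split.
  - exact: size_encode_graph.
  - by rewrite nth_encode_graph_unary ?ltnn.
  - by move=> i; rewrite nth_encode_graph_unary // ltnW.
  - rewrite matrix_at_encode_graph.
    have -> : matrix_at (rel_bits B ++ rel_bits M) 0 = B.
      apply: funext => i; apply: funext => j.
      by rewrite /matrix_at nth_cat size_rel_bits ltn_rel_bits_index nth_rel_bits.
    have -> : matrix_at (rel_bits B ++ rel_bits M) (n * n) = M.
      apply: funext => i; apply: funext => j.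
      by rewrite /matrix_at nth_cat size_rel_bits ltnNge leq_addr addKn nth_rel_bits.
    by [].
(* Soundness: the matrices found in an accepted word and its certificate yield simplicity, an
   interval model and a pairing strategy. *)
case=> u _ /holds_sumP[n /formula_bodyP[sx xn xi cert]].
exists n, (matrix_at x (n + 1)); split.
- exact: certifies_simple cert.
- exact: certifies_interval cert.
- exact: certifies_outcome_D cert.
- exact: encode_graph_matrix_at.
Qed.
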